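(* Let $N$ be a matroid on the finite set $E$ and let $H$ be a skew hyperfield. If $\mathcal{C}$ is a left $H$-signature of $N$ and $\mathcal{D}$ is a right $H$-signature of $N^*$ so that $\mathcal{C}\perp_3\mathcal{D}$, then $M=(E,\mathcal{C})$ is a left $H$-matroid and its dual is $M^*=(E,\mathcal{D})$ (in particular $(E,\mathcal{D})$ is a right $H$-matroid).
   Context: **Skew hyperfields.** A skew hyperfield is a tuple $(H,\cdot,\boxplus,1,0)$ with $0\neq 1$, where $\boxplus:H\times H\to 2^H\setminus\{\emptyset\}$ is commutative and associative (for subsets, $X\boxplus Y=\bigcup_{x\in X,y\in Y}x\boxplus y$; elements are identified with singletons), such that: $x\boxplus 0=\{x\}$; for each $x$ there is a unique element $-x$ with $0\in x\boxplus(-x)$; $x\in y\boxplus z$ iff $z\in x\boxplus(-y)$; $H^\star:=H\setminus\{0\}$ is a (not necessarily commutative) group under $\cdot$ with identity $1$; $0\cdot x=x\cdot 0=0$; $\alpha(x\boxplus y)=\alpha x\boxplus\alpha y$ and $(x\boxplus y)\alpha=x\alpha\boxplus y\alpha$. **Signatures and $H$-matroids.** For $X\in H^E$ put $\underline{X}:=\{e\in E:X_e\neq 0\}$, and $\underline{\mathcal{C}}:=\{\underline{X}:X\in\mathcal{C}\}$. Distinct $C,C'$ in a collection of sets form a modular pair if $C\cup C'$ does not properly contain the union of two distinct members of the collection; $X,Y\in\mathcal{C}$ are modular if $\underline{X},\underline{Y}$ are modular in $\underline{\mathcal{C}}$. Consider for $\mathcal{C}\subseteq H^E$: (C0) $0\notin\mathcal{C}$;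 (C1) if $X\in\mathcal{C}$, $\alpha\in H^\star$, then $\alpha X\in\mathcal{C}$; (C2) if $X,Y\in\mathcal{C}$ and $\underline{X}\subseteq\underline{Y}$, then $Y=\alpha X$ for some $\alpha\in H^\star$; (C3) if $X,Y\in\mathcal{C}$ are modular and $X_e=-Y_e\neq 0$, then there is $Z\in\mathcal{C}$ with $Z_e=0$ and $Z_f\in X_f\boxplus Y_f$ for all $f\in E$. $\mathcal{C}$ is a left $H$-signature of a matroid $N$ on $E$ if (C0)–(C2) hold and $\underline{\mathcal{C}}$ is the set of circuits of $N$. $(E,\mathcal{C})$ is a left $H$-matroid if (C0)–(C3) hold; its underlying matroid $\underline{M}$ is the matroid with circuits $\underline{\mathcal{C}}$. Right $H$-signatures and right $H$-matroids are defined in the same way with $\alpha X$ replaced by $X\alpha$ in (C1), (C2). **Orthogonality and duality.** $X\perp Y$ means $0\in\boxplus_{e\in E}X_e\cdot Y_e$. $\mathcal{C}\perp_k\mathcal{D}$ means $X\perp Y$ for all $X\in\mathcal{C}$, $Y\in\mathcal{D}$ with $|\underline{X}\cap\underline{Y}|\leq k$. $N^*$ is the dual matroid of $N$. A left $H$-matroid $M=(E,\mathcal{C})$ and a right $H$-matroid $M'=(E,\mathcal{D})$ are dual if $\underline{M}=\underline{M'}^*$ and $\mathcal{C}\perp_3\mathcal{D}$; each left $H$-matroid $M$ has a unique dual, denoted $M^*$. *)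

(* Defs.v *)
From mathcomp Require Import boolp classical_sets.
From mathcomp Require Import all_boot.

Set Implicit Arguments.
Unset Strict Implicit.
Unset Printing Implicit Defensive.

(* Sets of vectors over a hyperfield have the [Prop]-valued type [set T]; subsets
   of the finite ground set have type [{set E}]. *)

(** * Skew hyperfields *)

Definition set_add (T : Type) (add : T -> T -> set T) (X Y : set T) : set T :=
  (\bigcup_(x in X) \bigcup_(y in Y) add x y)%classic.

(* [hopp] is not extra structure: it is determined by [hadd] and [hzero]. *)
Record skewHyperfield := SkewHyperfield {
  hcarrier :> Type;
  hzero : hcarrier;
  hone : hcarrier;
  hopp : hcarrier -> hcarrier;
  hmul : hcarrier -> hcarrier -> hcarrier;
  hadd : hcarrier -> hcarrier -> set hcarrier;
  hzero_neq1 : hzero <> hone;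
  hadd_nonempty : forall x y, (hadd x y !=set0)%classic;
  haddC : forall x y, hadd x y = hadd y x;
  haddA : forall x y z,
    set_add hadd (hadd x y) [set z]%classic =
    set_add hadd [set x]%classic (hadd y z);
  haddx0 : forall x, hadd x hzero = [set x]%classic;
  hadd_opp : forall x, hadd x (hopp x) hzero;
  hopp_uniq : forall x y, hadd x y hzero -> y = hopp x;
  hadd_rev : forall x y z, hadd y z x <-> hadd x (hopp y) z;
  hmul_neq0 : forall x y, x <> hzero -> y <> hzero -> hmul x y <> hzero;
  hmulA : forall x y z, x <> hzero -> y <> hzero -> z <> hzero ->
    hmul x (hmul y z) = hmul (hmul x y) z;
  hmul1x : forall x, x <> hzero -> hmul hone x = x;
  hmulx1 : forall x, x <> hzero -> hmul x hone = x;
  hmul_inv : forall x, x <> hzero ->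
    exists y, [/\ y <> hzero, hmul y x = hone & hmul x y = hone];
  hmul0x : forall x, hmul hzero x = hzero;
  hmulx0 : forall x, hmul x hzero = hzero;
  hmulDr : forall a x y,
    [set hmul a z | z in hadd x y]%classic = hadd (hmul a x) (hmul a y);
  hmulDl : forall a x y,
    [set hmul z a | z in hadd x y]%classic = hadd (hmul x a) (hmul y a)
}.

Arguments hzero {_}.
Arguments hone {_}.

(* Since [{0}] is neutral for the sum of subsets, and that sum is associative
   and commutative, the order in which the index type is enumerated is
   irrelevant. *)
Definition hsum (H : skewHyperfield) (I : finType) (F : I -> H) : set H :=
  \big[set_add (@hadd H)/[set hzero]%classic]_(i : I) [set F i]%classic.

(** * Matroids *)

Record matroid (E : finType) := Matroid {
  bases : {set {set E}};
  bases_neq0 : exists B, B \in bases;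
  bases_exchange : forall B1 B2, B1 \in bases -> B2 \in bases ->
    forall x, x \in B1 :\: B2 ->
    exists2 y, y \in B2 :\: B1 & y |: (B1 :\ x) \in bases
}.

Definition independent (E : finType) (N : matroid E) : pred {set E} :=
  fun A => [exists B in bases N, A \subset B].

Definition circuits (E : finType) (N : matroid E) : {set {set E}} :=
  [set A | minset (fun A' => ~~ independent N A') A].

Section DualMatroid.
Variables (E : finType) (N : matroid E).

Let card_swap (B : {set E}) x y :
  x \in B -> y \notin B -> #|y |: (B :\ x)| = #|B|.
Proof.
move=> xB yB; rewrite cardsU1 (cardsD1 x B) xB !inE (negPf yB) andbF.
by [].
Qed.

Lemma bases_card_leq B1 B2 :
  B1 \in bases N -> B2 \in bases N -> #|B1| <= #|B2|.
Proof.
move=> + B2N; have [n] := ubnP #|B1 :\: B2|.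
elim: n B1 => // n IHn B1 lt_n B1N.
have [/eqP|[x xB]] := set_0Vmem (B1 :\: B2).
  by rewrite setD_eq0 => /subset_leq_card.
have [y yB By] := bases_exchange B1N B2N xB.
move: (xB) (yB); rewrite !inE => /andP[xB2 xB1] /andP[yB1 yB2].
rewrite -(card_swap xB1 yB1); apply: IHn By.
rewrite -ltnS; apply: leq_trans lt_n; rewrite ltnS; apply: proper_card.
apply/properP; split.
  apply/subsetP=> z; rewrite !inE => /andP[zB2].
  by case/orP=> [/eqP zy|/andP[_ ->]]; [rewrite -zy (negPf zB2) in yB2|rewrite zB2].
exists x => //; rewrite !inE eqxx /= orbF negb_and.
by apply/orP; right; apply: contraNneq xB2 => ->.
Qed.

Lemma bases_card B1 B2 : B1 \in bases N -> B2 \in bases N -> #|B1| = #|B2|.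
Proof. by move=> B1N B2N; apply/eqP; rewrite eqn_leq !bases_card_leq. Qed.

Lemma bases_coexchange B1 B2 x : B1 \in bases N -> B2 \in bases N ->
  x \in B2 :\: B1 -> exists2 y, y \in B1 :\: B2 & x |: (B1 :\ y) \in bases N.
Proof.
move=> B1N + /setDP[+ xB1].
suff key n B : #|B :\: B1| < n -> B \in bases N -> x \in B ->
    exists2 B', B' \in bases N &
      [/\ x \in B', B' :\: B1 \subset [set x] & B :&: B1 \subset B'].
  move=> B2N xB2; have [B' B'N [xB' B'x /subsetP sB]] := key _ B2 (ltnSn _) B2N xB2.
  have /card_gt0P[y] : 0 < #|B1 :\: B'|.
    rewrite cardsD subn_gt0 (bases_card B1N B'N) proper_card //.
    apply/properP; split; first exact: subsetIr.
    by exists x => //; rewrite inE (negPf xB1).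
  case/setDP=> yB1 yB'; exists y.
    rewrite !inE yB1 andbT; apply: contra yB' => yB2.
    by apply: sB; rewrite inE yB2.
  suff -> : x |: (B1 :\ y) = B' by [].
  apply/eqP; rewrite eq_sym eqEcard; apply/andP; split; last first.
    by rewrite card_swap // (bases_card B1N B'N).
  apply/subsetP=> z zB'; rewrite !inE.
  have [zB1|zB1] := boolP (z \in B1).
    by rewrite andbT orbC; apply/orP; left; apply: contraNneq yB' => <-.
  by have := subsetP B'x z; rewrite !inE zB1 zB' => ->.
elim: n B => // n IHn B lt_n BN xB.
have [sx|] := boolP (B :\: B1 \subset [set x]).
  by exists B => //; split=> //; apply: subsetIl.
case/subsetPn=> z zB; rewrite inE => zx.
have [w wB Bw] := bases_exchange BN B1N zB.
move: (zB) (wB); rewrite !inE => /andP[zB1 zB'] /andP[wB' wB1].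
have lt_n' : #|(w |: (B :\ z)) :\: B1| < n.
  rewrite -ltnS; apply: leq_trans lt_n; rewrite ltnS; apply: proper_card.
  apply/properP; split.
    apply/subsetP=> t; rewrite !inE => /andP[tB1].
    by case/orP=> [/eqP tw|/andP[_ ->]]; [rewrite -tw (negPf tB1) in wB1|rewrite tB1].
  exists z => //; rewrite !inE eqxx /= orbF negb_and.
  by apply/orP; right; apply: contraNneq zB1 => ->.
have xBw : x \in w |: (B :\ z) by rewrite !inE xB [x == z]eq_sym zx orbT.
have [B' B'N [xB' B'x sB]] := IHn _ lt_n' Bw xBw.
exists B' => //; split=> //; apply: subset_trans sB.
apply/subsetP=> t; rewrite !inE => /andP[tB tB1]; rewrite tB tB1 !andbT.
by apply/orP; right; apply: contraNneq zB1 => <-.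
Qed.

Definition dual_bases : {set {set E}} := [set ~: B | B in bases N].

Lemma mem_dual_bases B : (B \in dual_bases) = (~: B \in bases N).
Proof.
apply/imsetP/idP => [[B' B'N ->]|BN]; first by rewrite setCK.
by exists (~: B) => //; rewrite setCK.
Qed.

Lemma dual_bases_neq0 : exists B, B \in dual_bases.
Proof.
by have [B BN] := bases_neq0 N; exists (~: B); rewrite mem_dual_bases setCK.
Qed.

Lemma dual_bases_exchange B1 B2 : B1 \in dual_bases -> B2 \in dual_bases ->
  forall x, x \in B1 :\: B2 ->
  exists2 y, y \in B2 :\: B1 & y |: (B1 :\ x) \in dual_bases.
Proof.
rewrite !mem_dual_bases => B1N B2N x /setDP[xB1 xB2].
have [|y] := bases_coexchange (x := x) B1N B2N; first by rewrite !inE xB1 xB2.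
rewrite !inE negbK => /andP[yB2 yB1] Bxy; exists y; first by rewrite !inE yB1.
suff e : ~: (y |: (B1 :\ x)) = x |: (~: B1 :\ y).
  by rewrite mem_dual_bases e.
apply/setP=> z; rewrite !inE negb_or negb_and negbK.
by have [->|] := eqVneq z x; rewrite //= andbT; apply: contraTneq xB1 => ->.
Qed.

Definition dual : matroid E := Matroid dual_bases_neq0 dual_bases_exchange.

End DualMatroid.

(** * Signatures and matroids over a skew hyperfield *)

Section HyperfieldMatroids.
Variables (H : skewHyperfield) (E : finType).
Local Notation vec := {ffun E -> H}.
Implicit Types (X Y Z : vec) (C D : set vec) (N : matroid E).

Definition support X : {set E} := [set e | `[< X e <> hzero >]].

Definition supports C : {set {set E}} :=
  [set S | `[< exists2 X, C X & support X = S >]].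

Definition lscale (a : H) X : vec := [ffun e => hmul a (X e)].
Definition rscale (a : H) X : vec := [ffun e => hmul (X e) a].

Definition modular_pair (S : {set {set E}}) (A B : {set E}) : Prop :=
  [/\ A \in S, B \in S, A <> B &
    forall A' B', A' \in S -> B' \in S -> A' <> B' ->
      ~~ (A' :|: B' \proper A :|: B)].

Definition modular C X Y : Prop :=
  modular_pair (supports C) (support X) (support Y).

Definition axiom_C0 C : Prop := ~ C [ffun _ => hzero].

(* The axioms below that involve scalar multiples take the scaling action as a
   parameter: [lscale] for left and [rscale] for right signatures. *)
Definition axiom_C1 (scale : H -> vec -> vec) C : Prop :=
  forall a X, a <> hzero -> C X -> C (scale a X).

Definition axiom_C2 (scale : H -> vec -> vec) C : Prop :=
  forall X Y, C X -> C Y -> support X \subset support Y ->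
  exists2 a, a <> hzero & Y = scale a X.

Definition axiom_C3 C : Prop :=
  forall X Y e, C X -> C Y -> modular C X Y ->
    X e = hopp (Y e) -> X e <> hzero ->
  exists Z, [/\ C Z, Z e = hzero & forall f, hadd (X f) (Y f) (Z f)].

Definition signature scale N C : Prop :=
  [/\ axiom_C0 C, axiom_C1 scale C, axiom_C2 scale C &
      supports C = circuits N].

Definition hmatroid scale C : Prop :=
  [/\ axiom_C0 C, axiom_C1 scale C, axiom_C2 scale C & axiom_C3 C].

Definition left_signature := signature lscale.
Definition right_signature := signature rscale.
Definition left_hmatroid := hmatroid lscale.
Definition right_hmatroid := hmatroid rscale.

Definition underlying_matroid C N : Prop := circuits N = supports C.

Definition orthogonal X Y : Prop :=
  hsum (fun e => hmul (X e) (Y e)) hzero.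

Definition orthogonal_upto (k : nat) C D : Prop :=
  forall X Y, C X -> D Y -> #|support X :&: support Y| <= k -> orthogonal X Y.

(* A matroid is determined by its circuits, so [N] and [N'] below are the
   underlying matroids of [(E, C)] and [(E, D)]. *)
Definition dual_pair C D : Prop :=
  [/\ left_hmatroid C, right_hmatroid D,
      exists N N', [/\ underlying_matroid C N, underlying_matroid D N' &
                       N = dual N'] &
      orthogonal_upto 3 C D].

(* [(E, D)] is [M^*] for [M = (E, C)]: the one and only dual of [M]. *)
Definition is_dual C D : Prop := unique (dual_pair C) D.

End HyperfieldMatroids.

(* Main.v *)
From HB Require Import structures.
From mathcomp Require Import boolp classical_sets.
From mathcomp Require Import all_boot.
Require Import Defs.

(** Let X, Y be modular in C with X_e = -Y_e <> 0, and let A be the union of their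
    supports. Two families of vectors of D make the elimination axiom work.

    First, if I is an independent set of N and f \in I, then extending I to a base
    and taking the fundamental cocircuit of f yields W in D with W_f <> 0 that
    vanishes on the rest of I ([exists_covector]). Were A \ e independent, such a W
    would meet A at most in e and a point a of X outside Y; orthogonality to Y
    kills W_e and then orthogonality to X kills W_a. So A \ e contains a circuit,
    and this provides Z in C with Z_e = 0 ([circuit_elimination]); note that the
    elimination property of circuits comes from orthogonality as well.

    Second, let a be in X but not Y, b in Y but not X, and f in both supports. A
    circuit inside A \ {a, b} would form with the support of X a union that avoids b,
    against modularity. Hence A \ {a, b} is independent, and there is W in D with
    W_f <> 0 whose support meets A within {a, b, f} ([modular_covector]). Such a W
    is orthogonal to X, Y and Z, as only three coordinates are involved:
    -  X_a W_a = - X_f W_f  and  Y_b W_b = - Y_f W_f,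
    -  Z_a W_a [+] Z_b W_b [+] Z_f W_f contains 0.
    For f = e, where Z_e = 0 and X_e = -Y_e, these relations say that the ratio of
    Z_a to Z_b is the ratio of X_a to Y_b. So Z can be scaled to agree with X off Y
    and with Y off X. For the other f, substituting Z_a = X_a and Z_b = Y_b in the
    last relation gives Z_f W_f \in X_f W_f [+] Y_f W_f, and W_f cancels
    ([modular_elimination]).

    Exchanging the roles of C and D replaces left by right scalars, that is H by
    the opposite hyperfield, and N by its dual, so D satisfies the elimination
    axiom too ([right_modular_elimination]).

    For the uniqueness of the dual, a second dual D' has the same supports as D,
    since the circuits of a matroid determine its bases and hence the circuits of
    its dual. Orthogonality to the vectors of C that meet a given support S in just
    two points determines a vector with support S up to a right scalar
    ([orthogonal_ratio]), so D' = D. *)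

Set Implicit Arguments.
Unset Strict Implicit.
Unset Printing Implicit Defensive.

(** * Arithmetic in a skew hyperfield *)

Section Arithmetic.
Variable H : skewHyperfield.
Implicit Types (x y z a : H) (X Y Z : set H).

Lemma hmul_assoc x y z : hmul x (hmul y z) = hmul (hmul x y) z.
Proof.
have [->|x0] := pselect (x = hzero); first by rewrite !hmul0x.
have [->|y0] := pselect (y = hzero); first by rewrite !(hmul0x, hmulx0).
have [->|z0] := pselect (z = hzero); first by rewrite !hmulx0.
exact: hmulA.
Qed.

Lemma hmul1 x : hmul hone x = x.
Proof.
have [->|] := pselect (x = hzero); [exact: hmulx0|exact: hmul1x].
Qed.

Lemma hmulr1 x : hmul x hone = x.
Proof.
have [->|] := pselect (x = hzero); [exact: hmul0x|exact: hmulx1].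
Qed.

Lemma hmul_eq0 x y : hmul x y = hzero -> x = hzero \/ y = hzero.
Proof.
move=> xy; have [|x0] := pselect (x = hzero); first by left.
have [|y0] := pselect (y = hzero); first by right.
by case: (hmul_neq0 x0 y0 xy).
Qed.

Lemma hmulIr a x y : a <> hzero -> hmul x a = hmul y a -> x = y.
Proof.
move=> /hmul_inv[b [_ _ ab]] /(congr1 (fun z => hmul z b)).
by rewrite -!hmul_assoc ab !hmulr1.
Qed.

Lemma hmulIl a x y : a <> hzero -> hmul a x = hmul a y -> x = y.
Proof.
move=> /hmul_inv[b [_ ba _]] /(congr1 (hmul b)).
by rewrite !hmul_assoc ba !hmul1.
Qed.

Lemma haddMl a x y z : hadd x y z -> hadd (hmul a x) (hmul a y) (hmul a z).
Proof. by move=> h; rewrite -hmulDr; exists z. Qed.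

Lemma haddMr a x y z : hadd x y z -> hadd (hmul x a) (hmul y a) (hmul z a).
Proof. by move=> h; rewrite -hmulDl; exists z. Qed.

Lemma haddMr_inv a x y z : a <> hzero ->
  hadd (hmul x a) (hmul y a) (hmul z a) -> hadd x y z.
Proof. by move=> a0; rewrite -hmulDl => -[t xyt /(hmulIr a0) <-]. Qed.

Lemma hadd0x_eq x z : hadd hzero x z -> z = x.
Proof. by rewrite haddC haddx0. Qed.

Lemma haddx0_eq x z : hadd x hzero z -> z = x.
Proof. by rewrite haddx0. Qed.

Lemma hadd0_eq x y z : hadd x y hzero -> hadd x z hzero -> y = z.
Proof. by move=> /hopp_uniq -> /hopp_uniq ->. Qed.

Lemma hoppK x : hopp (hopp x) = x.
Proof. by apply/esym/hopp_uniq; rewrite haddC; apply: hadd_opp. Qed.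

(** Turns facts about negation into instances of distributivity. *)
Lemma hoppE x : hopp x = hmul (hopp hone) x.
Proof.
apply/esym/hopp_uniq.
by have := haddMr x (hadd_opp (hone : H)); rewrite hmul1 hmul0x.
Qed.

Lemma hadd_hopp x y z : hadd x y z -> hadd (hopp x) (hopp y) (hopp z).
Proof. by rewrite (hoppE x) (hoppE y) (hoppE z); apply: haddMl. Qed.

Lemma hmulNr x y : hmul (hopp x) y = hopp (hmul x y).
Proof. by rewrite (hoppE x) -hmul_assoc -hoppE. Qed.

Lemma set_addP X Y z :
  set_add (@hadd H) X Y z <-> exists x y, [/\ X x, Y y & hadd x y z].
Proof.
split=> [[x Xx [y Yy h]]|[x [y [Xx Yy h]]]]; first by exists x, y.
by exists x => //; exists y.
Qed.

Lemma set_add1 x y : set_add (@hadd H) [set x]%classic [set y]%classic = hadd x y.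
Proof. by rewrite /set_add !bigcup_set1. Qed.

Lemma set_addC : commutative (set_add (@hadd H)).
Proof.
move=> X Y; apply/predeqP => z; split=> /set_addP[x [y [Xx Yy h]]];
  by apply/set_addP; exists y, x; rewrite haddC.
Qed.

Lemma set_add0 : left_id [set hzero]%classic (set_add (@hadd H)).
Proof.
move=> X; apply/predeqP => z; split.
  by move/set_addP=> [_ [x [/= -> Xx /hadd0x_eq ->]]].
by move=> Xz; apply/set_addP; exists hzero, z; rewrite haddC haddx0.
Qed.

Lemma set_addA : associative (set_add (@hadd H)).
Proof.
move=> X Y Z; apply/predeqP => t; split.
  move/set_addP=> [x [w [Xx /set_addP[y [z [Yy Zz yz]]] xt]]].
  have : set_add (@hadd H) [set x]%classic (hadd y z) t.
    by apply/set_addP; exists x, w.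
  rewrite -haddA => /set_addP[u [_ [xy /= -> ut]]].
  by apply/set_addP; exists u, z; split=> //; apply/set_addP; exists x, y.
move/set_addP=> [w [z [/set_addP[x [y [Xx Yy xy]]] Zz xt]]].
have : set_add (@hadd H) (hadd x y) [set z]%classic t.
  by apply/set_addP; exists w, z.
rewrite haddA => /set_addP[_ [u [/= -> yz ut]]].
by apply/set_addP; exists x, u; split=> //; apply/set_addP; exists y, z.
Qed.

(** The big sums defining orthogonality may thus be reordered and their zero
    terms dropped. *)
HB.instance Definition _ := Monoid.isComLaw.Build (set H) [set hzero]%classic
  (set_add (@hadd H)) set_addA set_addC set_add0.

Lemma hsum2 (I : finType) (F : I -> H) i j : i != j ->
  (forall k, k != i -> k != j -> F k = hzero) -> hsum F = hadd (F i) (F j).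
Proof.
move=> ij F0; rewrite /hsum (bigD1 i) //= (bigD1 j) 1?eq_sym //=.
rewrite big1 ?Monoid.mulm1 ?set_add1 // => k /andP[ki kj].
by rewrite F0.
Qed.

Lemma hsum3 (I : finType) (F : I -> H) i j k :
  i != j -> i != k -> j != k ->
  (forall l, l != i -> l != j -> l != k -> F l = hzero) ->
  hsum F = set_add (@hadd H) (hadd (F i) (F j)) [set F k]%classic.
Proof.
move=> ij ik jk F0; rewrite /hsum (bigD1 i) //= (bigD1 j) 1?eq_sym //=.
rewrite (bigD1 k) /= 1?[k == i]eq_sym 1?[k == j]eq_sym ?ik //.
rewrite big1 ?Monoid.mulm1 ?Monoid.mulmA /= ?set_add1 // => l /andP[/andP[li lj] lk].
by rewrite F0.
Qed.

End Arithmetic.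

(** * Circuits and cocircuits *)

Section MatroidFacts.
Variable E : finType.
Implicit Types (N M : matroid E) (A B S T : {set E}).

Lemma dependent_circuit N A :
  ~~ independent N A -> exists2 S, S \in circuits N & S \subset A.
Proof.
case/(minset_exists (P := fun A' => ~~ independent N A')) => S mS SA.
by exists S; rewrite ?inE.
Qed.

Lemma circuit_dependent N S : S \in circuits N -> ~~ independent N S.
Proof. by rewrite inE => /minsetp. Qed.

Lemma circuit_del_independent N S f :
  S \in circuits N -> f \in S -> independent N (S :\ f).
Proof.
rewrite inE => /minsetP[_ minS] fS; apply: contraT => dep.
by have /setP/(_ f) := minS _ dep (subD1set _ _); rewrite !inE eqxx fS.
Qed.

Lemma independent_sub N A B : A \subset B -> independent N B -> independent N A.
Proof.
move=> AB /exists_inP[B' BN' BB']; apply/exists_inP; exists B' => //.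
exact: subset_trans BB'.
Qed.

Lemma independent_circuits N A :
  independent N A = [forall S in circuits N, ~~ (S \subset A)].
Proof.
apply/idP/forall_inP => [indA S cS|noS].
  by apply: contra (circuit_dependent cS) => /independent_sub ->.
apply: contraT => /dependent_circuit[S cS].
by rewrite (negPf (noS S cS)).
Qed.

(** Bases are the maximal independent sets. The condition is phrased with
    independence only, so that independence visibly determines the bases. *)
Lemma mem_bases N B :
  (B \in bases N) =
  [forall A : {set E}, (B \subset A) ==> (independent N A == (A == B))].
Proof.
apply/idP/forallP => [BN A|h].
  apply/implyP => BA; apply/eqP; apply/exists_inP/eqP => [[B' B'N AB']|->].
    apply/eqP; rewrite eq_sym eqEcard BA /= (bases_card BN B'N).
    exact: subset_leq_card.
  by exists B.
have := h B; rewrite subxx eqxx /= => /eqP/exists_inP[B' B'N BB'].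
have := h B'; rewrite BB' /= => /eqP.
have -> : independent N B' by apply/exists_inP; exists B'.
by move/esym/eqP <-.
Qed.

Lemma circuits_inj N M : circuits N = circuits M -> bases N = bases M.
Proof.
move=> NM; apply/setP => B; rewrite !mem_bases.
by apply: eq_forallb => A; rewrite !independent_circuits NM.
Qed.

Lemma eq_bases_circuits N M : bases N = bases M -> circuits N = circuits M.
Proof. by move=> NM; rewrite /circuits /independent NM. Qed.

Lemma bases_dualK N : bases (dual (dual N)) = bases N.
Proof. by apply/setP => B; rewrite !mem_dual_bases setCK. Qed.

Lemma eq_bases_dual N M : bases N = bases M -> bases (dual N) = bases (dual M).
Proof. by move=> NM; apply/setP => B; rewrite !mem_dual_bases NM. Qed.

Lemma independent_dual N A :
  independent (dual N) A = [exists B in bases N, [disjoint B & A]].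
Proof.
apply/exists_inP/exists_inP => -[B BN AB]; exists (~: B).
- by rewrite -mem_dual_bases.
- by rewrite disjoint_sym disjoints_subset setCK.
- by rewrite mem_dual_bases setCK.
- by rewrite -disjoints_subset disjoint_sym.
Qed.

Definition fundamental_cocircuit N B f : {set E} :=
  [set x | x |: (B :\ f) \in bases N].

Lemma fundamental_cocircuit_self N B f : B \in bases N -> f \in B ->
  f \in fundamental_cocircuit N B f.
Proof. by move=> BN fB; rewrite inE setD1K. Qed.

Lemma fundamental_cocircuit_base N B f z : B \in bases N -> f \in B ->
  z \in B -> z != f -> z \notin fundamental_cocircuit N B f.
Proof.
move=> BN fB zB zf; rewrite inE; apply/negP => Bz.
have := bases_card Bz BN.
by rewrite (cardsD1 f B) fB add1n cardsU1 !inE zf zB /= add0n => /n_Sn.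
Qed.

(** Let T be the fundamental cocircuit. A base B' disjoint from T would miss f, so
    that B \ f could be completed to a base by some y \in B', putting y in T.
    Conversely, if x \in T then the base x + (B \ f) meets T only in x, so T with x
    removed is independent in the dual. *)
Lemma fundamental_cocircuitP N B f : B \in bases N -> f \in B ->
  fundamental_cocircuit N B f \in circuits (dual N).
Proof.
move=> BN fB; rewrite inE; apply/minsetP; split=> [|T].
  rewrite independent_dual; apply/exists_inP => -[B' B'N dB'].
  have fB' : f \in B :\: B'.
    rewrite inE fB andbT; apply/negP => /(disjointFr dB').
    by rewrite inE setD1K ?BN.
  have [y yB' By] := bases_exchange BN B'N fB'.
  by move: yB'; rewrite inE => /andP[_ /(disjointFr dB')]; rewrite inE By.
rewrite independent_dual => depT subT; apply/eqP; rewrite eqEsubset subT /=.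
apply/subsetP => x; rewrite inE => Bx; apply: contraR depT => xT.
apply/exists_inP; exists (x |: (B :\ f)) => //.
rewrite disjoint_subset; apply/subsetP => z; rewrite !inE.
case/predU1P => [->|/andP[zf zB]] //; apply/negP => /(subsetP subT).
by rewrite (negPf (fundamental_cocircuit_base BN fB zB zf)).
Qed.

End MatroidFacts.

(** * Elimination from orthogonality *)

Section Elimination.
Variables (H : skewHyperfield) (E : finType).
Local Notation vec := {ffun E -> H}.
Implicit Types (X Y Z W : vec) (C D : set vec) (N : matroid E).

Lemma supportP X e : reflect (X e <> hzero) (e \in support X).
Proof. by rewrite inE; apply: asboolP. Qed.

Lemma supportPn X e : reflect (X e = hzero) (e \notin support X).
Proof. by rewrite inE; apply: (iffP (asboolPn _)) => [/contrapT|->]. Qed.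

Lemma mem_supports C X : C X -> support X \in supports C.
Proof. by move=> CX; rewrite inE; apply/asboolP; exists X. Qed.

Lemma supports_mem C S : S \in supports C -> exists2 X, C X & support X = S.
Proof. by rewrite inE => /asboolP. Qed.

(** The source of all the vectors to which orthogonality is applied: a
    fundamental cocircuit meets the chosen base, hence I, only in f. *)
Lemma exists_covector N D I f : supports D = circuits (dual N) ->
  independent N I -> f \in I ->
  exists W, [/\ D W, W f <> hzero &
    forall g, g \in I -> g != f -> W g = hzero].
Proof.
move=> sD /exists_inP[B BN IB] fI; have fB := subsetP IB f fI.
have := fundamental_cocircuitP BN fB; rewrite -sD => /supports_mem[W DW sW].
exists W; split=> // [|g gI gf].
  by apply/supportP; rewrite sW fundamental_cocircuit_self.
by apply/supportPn; rewrite sW fundamental_cocircuit_base // (subsetP IB).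
Qed.

Lemma orthogonal_pair C D X W e f : orthogonal_upto 3 C D -> C X -> D W ->
  e != f -> (forall g, g != e -> g != f -> X g = hzero \/ W g = hzero) ->
  hadd (hmul (X e) (W e)) (hmul (X f) (W f)) hzero.
Proof.
move=> CD CX DW ef XW0.
rewrite -(hsum2 (F := fun e => hmul (X e) (W e)) ef); last first.
  by move=> g ge gf; case: (XW0 g ge gf) => ->; rewrite ?hmul0x ?hmulx0.
apply: (CD _ _ CX DW); apply: (@leq_trans #|[set e; f]|); last by rewrite cards2 ef.
apply/subset_leq_card/subsetP => g; rewrite !inE => /andP[/asboolP Xg /asboolP Wg].
apply/negPn; rewrite negb_or; apply/negP => /andP[ge gf].
by case: (XW0 g ge gf).
Qed.

Lemma orthogonal_triple C D X W a b f : orthogonal_upto 3 C D -> C X -> D W ->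
  a != b -> a != f -> b != f ->
  (forall g, g != a -> g != b -> g != f -> X g = hzero \/ W g = hzero) ->
  exists2 t, hadd (hmul (X a) (W a)) (hmul (X b) (W b)) t &
             hadd t (hmul (X f) (W f)) hzero.
Proof.
move=> CD CX DW ab af bf XW0.
suff : orthogonal X W.
  rewrite /orthogonal (hsum3 ab af bf); first by
    move/set_addP=> [t [_ [ht /= -> h0]]]; exists t.
  by move=> g ga gb gf; case: (XW0 g ga gb gf) => ->; rewrite ?hmul0x ?hmulx0.
apply: (CD _ _ CX DW); apply: (@leq_trans #|[set a; b; f]|); last first.
  by rewrite setUC cardsU1 cards2 ab; case: (_ \notin _).
apply/subset_leq_card/subsetP => g; rewrite !inE => /andP[/asboolP Xg /asboolP Wg].
apply/negPn; rewrite !negb_or; apply/negP => /andP[/andP[ga gb] gf].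
by case: (XW0 g ga gb gf).
Qed.

Section C3.
Variables (N : matroid E) (C D : set vec).
Hypotheses (hC : left_signature N C) (sD : supports D = circuits (dual N)).
Hypothesis hCD : orthogonal_upto 3 C D.

Lemma lscale_support a X : a <> hzero -> support (lscale a X) = support X.
Proof.
move=> a0; apply/setP => e; apply/supportP/supportP; rewrite ffunE.
  by move=> aX X0; apply: aX; rewrite X0 hmulx0.
by move=> X0 /hmul_eq0[].
Qed.

(** Circuits with distinct supports are incomparable. *)
Lemma signature_not_sub X Y : C X -> C Y -> support X <> support Y ->
  exists2 a, X a <> hzero & Y a = hzero.
Proof.
case: hC => _ _ hC2 _ CX CY XY.
have [/(hC2 _ _ CX CY)[a a0 Yx]|/subsetPn[a /supportP Xa /supportPn Ya]] :=
    boolP (support X \subset support Y); last by exists a.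
by case: XY; rewrite Yx lscale_support.
Qed.

(** If the set on the right were independent, a vector W of D could be found that
    meets the two supports only in e and in one point a outside the support of
    Y. Then W_e = 0 because W is orthogonal to Y, and W_a = 0 because W is
    orthogonal to X. *)
Lemma circuit_elimination X Y e : C X -> C Y -> support X <> support Y ->
  X e <> hzero -> Y e <> hzero ->
  exists2 Z, C Z & support Z \subset (support X :|: support Y) :\ e.
Proof.
move=> CX CY XY Xe Ye; have [_ _ _ sC] := hC.
have [ind|] := boolP (independent N ((support X :|: support Y) :\ e)); last first.
  by case/dependent_circuit => S; rewrite -sC => /supports_mem[Z CZ <-]; exists Z.
have [a Xa Ya] := signature_not_sub CX CY XY.
have ae : a != e by apply/eqP => ae; rewrite ae in Ya.
have aI : a \in (support X :|: support Y) :\ e.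
  by rewrite in_setD1 ae in_setU; apply/orP; left; apply/supportP.
have [W [DW Wa W0]] := exists_covector sD ind aI.
have V0 (V : vec) : support V \subset support X :|: support Y ->
    forall g, g != a -> g != e -> V g = hzero \/ W g = hzero.
  move=> /subsetP sV g ga ge; have [gV|gV] := boolP (g \in support V).
    by right; apply: W0 => //; rewrite in_setD1 ge sV.
  by left; apply/supportPn.
have := orthogonal_pair hCD CY DW ae (V0 _ (subsetUr _ _)).
rewrite Ya hmul0x => /hadd0x_eq/esym/hmul_eq0[//|We].
have := orthogonal_pair hCD CX DW ae (V0 _ (subsetUl _ _)).
by rewrite We hmulx0 => /haddx0_eq/esym/hmul_eq0[].
Qed.

(** A circuit in this set avoids a, so it differs from the support of X; and its
    union with that support avoids b, which modularity forbids. *)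
Lemma modular_independent X Y a b : C X -> C Y -> modular C X Y ->
  X a <> hzero -> Y a = hzero -> Y b <> hzero -> X b = hzero ->
  independent N ((support X :|: support Y) :\: [set a; b]).
Proof.
move=> CX CY [_ _ _ modXY] Xa Ya Yb Xb; have [_ _ _ sC] := hC.
apply: contraT => /dependent_circuit[S cS /subsetP SA].
have XS : support X <> S.
  move=> XS; have : a \in S by rewrite -XS; apply/supportP.
  by move/SA; rewrite !inE eqxx.
rewrite -sC in cS; have /negP[] := modXY _ _ (mem_supports CX) cS XS.
apply/properP; split.
  rewrite subUset subsetUl /=; apply/subsetP => z /SA.
  by rewrite in_setD => /andP[].
exists b; first by rewrite in_setU; apply/orP; right; apply/supportP.
rewrite in_setU negb_or; apply/andP; split; first by apply/supportPn.
by apply/negP => /SA; rewrite !inE eqxx orbT.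
Qed.

(** The vector W meets the union of the supports within {a, b, f}, so all of its
    orthogonality relations with vectors living there have at most three terms. *)
Lemma modular_covector X Y a b f : C X -> C Y -> modular C X Y ->
  X a <> hzero -> Y a = hzero -> Y b <> hzero -> X b = hzero ->
  X f <> hzero -> Y f <> hzero ->
  exists W, [/\ D W, W f <> hzero,
    hadd (hmul (X a) (W a)) (hmul (X f) (W f)) hzero,
    hadd (hmul (Y b) (W b)) (hmul (Y f) (W f)) hzero &
    forall Z, C Z -> support Z \subset support X :|: support Y ->
      exists2 t, hadd (hmul (Z a) (W a)) (hmul (Z b) (W b)) t &
                 hadd t (hmul (Z f) (W f)) hzero].
Proof.
move=> CX CY mXY Xa Ya Yb Xb Xf Yf.
have ab : a != b by apply/eqP => ab; rewrite ab in Xa.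
have af : a != f by apply/eqP => af; rewrite af in Ya.
have bf : b != f by apply/eqP => bf; rewrite bf in Xb.
have ind := modular_independent CX CY mXY Xa Ya Yb Xb.
have fI : f \in (support X :|: support Y) :\: [set a; b].
  rewrite in_setD in_set2 negb_or ![f == _]eq_sym af bf in_setU.
  by apply/orP; left; apply/supportP.
have [W [DW Wf W0]] := exists_covector sD ind fI.
have key Z : C Z -> support Z \subset support X :|: support Y ->
    exists2 t, hadd (hmul (Z a) (W a)) (hmul (Z b) (W b)) t &
               hadd t (hmul (Z f) (W f)) hzero.
  move=> CZ /subsetP sZ; apply: (orthogonal_triple hCD CZ DW ab af bf) => g ga gb gf.
  have [gZ|gZ] := boolP (g \in support Z); last by left; apply/supportPn.
  by right; apply: W0 => //; rewrite in_setD in_set2 negb_or ga gb sZ.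
exists W; split=> //.
  have [t] := key X CX (subsetUl _ _).
  by rewrite Xb hmul0x => /haddx0_eq ->.
have [t] := key Y CY (subsetUr _ _).
by rewrite Ya hmul0x => /hadd0x_eq ->.
Qed.

Lemma modular_elimination : axiom_C3 C.
Proof.
move=> X Y e CX CY mXY Xe Xe0; have [_ hC1 hC2 _] := hC.
have Ye0 : Y e <> hzero.
  move=> Ye; apply: Xe0; rewrite Xe Ye.
  by apply/esym/hopp_uniq; rewrite haddx0.
have XY : support X <> support Y by case: mXY.
have [Z0 CZ0 sZ0] := circuit_elimination CX CY XY Xe0 Ye0.
(* Take f = e in the covector lemma, with w = W_a and v = W_b: it forces the ratio of Z_a to Z_b
   to be that of X_a to Y_b. *)
have balance a b : X a <> hzero -> Y a = hzero -> Y b <> hzero -> X b = hzero ->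
  exists w v, [/\ w <> hzero, v <> hzero,
    hadd (hmul (X a) w) (hmul (Y b) v) hzero &
    forall Z, C Z -> support Z \subset (support X :|: support Y) :\ e ->
      hadd (hmul (Z a) w) (hmul (Z b) v) hzero].
  move=> Xa Ya Yb Xb.
  have [W [DW We hX hY hZ]] := modular_covector CX CY mXY Xa Ya Yb Xb Xe0 Ye0.
  exists (W a), (W b); split.
  - move=> Wa; move: hX; rewrite Wa hmulx0 => /hadd0x_eq/esym.
    by case/hmul_eq0.
  - move=> Wb; move: hY; rewrite Wb hmulx0 => /hadd0x_eq/esym.
    by case/hmul_eq0.
  - suff -> : hmul (X a) (W a) = hmul (Y e) (W e) by rewrite haddC.
    rewrite haddC in hX; apply: (hadd0_eq hX).
    by rewrite Xe hmulNr haddC; apply: hadd_opp.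
  - move=> Z CZ sZ; have [|t ht] := hZ Z CZ.
      exact: subset_trans sZ (subsetDl _ _).
    have -> : Z e = hzero.
      by apply/supportPn/negP => /(subsetP sZ); rewrite !inE eqxx.
    by rewrite hmul0x => /haddx0_eq t0; rewrite t0.
have [a Xa Ya] := signature_not_sub CX CY XY.
have YX : support Y <> support X by move=> YX; apply: XY.
have [b Yb Xb] := signature_not_sub CY CX YX.
have Z0a : Z0 a <> hzero.
  (* Otherwise Z0 vanishes on all of Y outside X, so its support lies in that of
     X; being circuits the two supports agree, yet Z0 vanishes at e. *)
  move=> Z0a; have Z0e : Z0 e = hzero.
    by apply/supportPn/negP => /(subsetP sZ0); rewrite !inE eqxx.
  have [|c _ Xc] := hC2 Z0 X CZ0 CX; last first.
    by apply: Xe0; rewrite Xc ffunE Z0e hmulx0.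
  apply/subsetP => g gZ; have /supportP Zg := gZ.
  apply/negPn/negP => /supportPn Xg.
  have /(subsetP sZ0) : g \in support Z0 by [].
  rewrite in_setD1 in_setU => /andP[_ /orP[/supportP //|/supportP Yg]].
  have [w [v [_ v0 _ /(_ _ CZ0 sZ0)]]] := balance a g Xa Ya Yg Xg.
  by rewrite Z0a hmul0x => /hadd0x_eq/esym/hmul_eq0[].
have [i [i0 iZ _]] := hmul_inv Z0a.
have c0 := hmul_neq0 Xa i0.
pose Z := lscale (hmul (X a) i) Z0.
have CZ : C Z by apply: hC1.
have sZ : support Z \subset (support X :|: support Y) :\ e.
  by rewrite lscale_support.
have Ze : Z e = hzero.
  by apply/supportPn/negP => /(subsetP sZ); rewrite !inE eqxx.
have Za : Z a = X a by rewrite ffunE -hmul_assoc iZ hmulr1.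
(* The scaling fixes Z at a; balance against a gives Z = Y on all of Y outside X,
   and balance against b then gives Z = X on all of X outside Y. *)
have ZY g : Y g <> hzero -> X g = hzero -> Z g = Y g.
  move=> Yg Xg; have [w [v [_ v0 hXY /(_ _ CZ sZ)]]] := balance a g Xa Ya Yg Xg.
  by rewrite Za => /(hadd0_eq hXY)/(hmulIr v0).
have ZX g : X g <> hzero -> Y g = hzero -> Z g = X g.
  move=> Xg Yg; have [w [v [w0 _ hXY /(_ _ CZ sZ)]]] := balance g b Xg Yg Yb Xb.
  rewrite (ZY b) // haddC => hZY; rewrite haddC in hXY.
  by apply: (hmulIr w0); apply: (hadd0_eq hZY).
exists Z; split=> // f.
have [Xf|Xf] := pselect (X f = hzero).
  rewrite Xf haddC haddx0 /=; have [Yf|Yf] := pselect (Y f = hzero); last exact: ZY.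
  rewrite Yf; apply/supportPn/negP => /(subsetP sZ).
  by rewrite in_setD1 in_setU => /andP[_ /orP[] /supportP].
have [Yf|Yf] := pselect (Y f = hzero).
  by rewrite Yf haddx0; apply: ZX.
have [W [_ Wf hX hY]] := modular_covector CX CY mXY Xa Ya Yb Xb Xf Yf.
case/(_ Z CZ (subset_trans sZ (subsetDl _ _))) => t.
(* Here t \in X_a W_a [+] Y_b W_b, while Z_f W_f = -t, X_f W_f = - X_a W_a and
   Y_f W_f = - Y_b W_b. *)
rewrite Za (ZY b) // => ht ht0; apply: (haddMr_inv Wf).
rewrite haddC in hX; rewrite haddC in hY.
rewrite (hopp_uniq ht0) -[hmul (X f) _]hoppK -[hmul (Y f) _]hoppK.
by rewrite -(hopp_uniq hX) -(hopp_uniq hY); apply: hadd_hopp.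
Qed.

End C3.

(** * Uniqueness of the dual *)

(** For e <> f in the common support S of Y and Y', the set S \ f is independent
    because S is a circuit, so some X in C has X_e <> 0 and meets S within {e, f}.
    Both 0 \in X_e Y_e [+] X_f Y_f and its analogue for Y' then determine the ratio
    between the entries at e and f in the same way, so the scalar that matches
    Y with Y' at f matches them everywhere. *)
Lemma orthogonal_ratio M C D D' Y Y' :
  supports C = circuits (dual M) -> supports D = circuits M ->
  orthogonal_upto 3 C D -> orthogonal_upto 3 C D' ->
  D Y -> D' Y' -> support Y' = support Y -> support Y != set0 ->
  exists2 a, a <> hzero & Y' = rscale a Y.
Proof.
move=> sC sD CD CD' DY DY' sY /set0Pn[f fY].
have /supportP Yf := fY; have /supportP Y'f : f \in support Y' by rewrite sY.
have [i [i0 _ Yi]] := hmul_inv Yf.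
exists (hmul i (Y' f)); first exact: hmul_neq0.
apply/ffunP => e; rewrite ffunE.
have [->|ef] := eqVneq e f; first by rewrite hmul_assoc Yi hmul1.
have [eY|eY] := boolP (e \in support Y); last first.
  have /supportPn -> : e \notin support Y' by rewrite sY.
  by have /supportPn -> := eY; rewrite hmul0x.
have ind : independent M (support Y :\ f).
  by apply: circuit_del_independent fY; rewrite -sD mem_supports.
have eI : e \in support Y :\ f by rewrite in_setD1 ef.
have [X [CX Xe X0]] := exists_covector sC ind eI.
have V0 (V : vec) : support V = support Y ->
    forall g, g != f -> g != e -> X g = hzero \/ V g = hzero.
  move=> sV g gf ge; have [gY|gY] := boolP (g \in support Y).
    by left; apply: X0 => //; rewrite in_setD1 gf.
  by right; apply/supportPn; rewrite sV.
have fe : f != e by rewrite eq_sym.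
have hY := orthogonal_pair CD CX DY fe (V0 _ erefl).
have hY' := orthogonal_pair CD' CX DY' fe (V0 _ sY).
have := haddMr (hmul i (Y' f)) hY; rewrite hmul0x -!hmul_assoc.
rewrite [hmul (Y f) _]hmul_assoc Yi hmul1.
by move/(hadd0_eq hY')/(hmulIl Xe).
Qed.

End Elimination.

(** * Left-right symmetry *)

Section Opposite.
Variable H : skewHyperfield.

(** Transparent, since the conversions between H and its opposite must compute. *)
Definition opposite : skewHyperfield.
Proof.
refine (@SkewHyperfield H hzero hone (@hopp H) (fun x y => hmul y x) (@hadd H)
  (@hzero_neq1 H) (@hadd_nonempty H) (@haddC H) (@haddA H) (@haddx0 H)
  (@hadd_opp H) (@hopp_uniq H) (@hadd_rev H) _ _ (@hmulx1 H) (@hmul1x H) _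
  (@hmulx0 H) (@hmul0x H) (@hmulDl H) (@hmulDr H)).
- by move=> x y x0 y0; apply: hmul_neq0.
- by move=> x y z x0 y0 z0; rewrite -hmulA.
- by move=> x /hmul_inv[y [y0 yx xy]]; exists y.
Defined.

End Opposite.

(** Over the opposite hyperfield, right scaling is left scaling and orthogonality
    with its two arguments exchanged is the same relation, both by conversion. *)
Lemma right_modular_elimination (H : skewHyperfield) (E : finType)
    (N : matroid E) (C D : set {ffun E -> H}) :
  right_signature (dual N) D -> supports C = circuits N ->
  orthogonal_upto 3 C D -> axiom_C3 D.
Proof.
move=> hD sC hCD.
apply: (@modular_elimination (opposite H) E (dual N) D C) => //.
  by rewrite (eq_bases_circuits (bases_dualK N)).
by move=> Y X DY CX; rewrite setIC; apply: hCD.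
Qed.

Theorem theorem2 (E : finType) (N : matroid E) (H : skewHyperfield)
    (C D : set {ffun E -> H})
    (hC : left_signature N C)
    (hD : right_signature (dual N) D)
    (hCD : orthogonal_upto 3 C D) :
  left_hmatroid C /\ is_dual C D.
Proof.
have [C0 C1 C2 sC] := hC; have [D0 D1 D2 sD] := hD.
have lC : left_hmatroid C by split=> //; apply: (modular_elimination hC sD hCD).
have sC' : supports C = circuits (dual (dual N)).
  by rewrite sC (eq_bases_circuits (bases_dualK N)).
have rD : right_hmatroid D.
  by split=> //; apply: (right_modular_elimination hD sC hCD).
split=> //; split.
  by split=> //; exists (dual (dual N)), (dual N); split.
move=> D' [_ [D'0 D'1 _ _] [M [M' [sM sM' MM']]] hCD'].
(* The matroid M' underlying D' has a dual with the circuits of N, hence with the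
   bases of N, so M' has the bases of the dual of N. *)
have sDD' : supports D' = supports D.
  rewrite sD -sM'; apply: eq_bases_circuits.
  rewrite -bases_dualK; apply: eq_bases_dual; apply: circuits_inj.
  by rewrite -MM' [LHS]sM.
have supp0 (V : {ffun E -> H}) : support V = set0 -> V = [ffun=> hzero].
  move=> V0; apply/ffunP => e; rewrite ffunE; apply/supportPn.
  by rewrite V0 inE.
apply/predeqP => Y; split=> hY.
  have := mem_supports hY; rewrite -sDD' => /supports_mem[Y' hY' sY].
  have Y'0 : support Y' != set0.
    by apply/eqP => /supp0 Y'0; apply: D'0; rewrite -Y'0.
  have sD' : supports D' = circuits (dual N) by rewrite sDD'.
  have [|a a0 ->] := orthogonal_ratio sC' sD' hCD' hCD hY' hY _ Y'0; first by [].
  exact: D'1.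
have := mem_supports hY; rewrite sDD' => /supports_mem[Y' hY' sY].
have Y'0 : support Y' != set0.
  by apply/eqP => /supp0 Y'0; apply: D0; rewrite -Y'0.
have [|a a0 ->] := orthogonal_ratio sC' sD hCD hCD' hY' hY _ Y'0; first by [].
exact: D1.
Qed.
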